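(* Let $G$ be a finite nonabelian group having a $2$-abelian partition (with respect to some abelian subgroup), and let $m=|Z(G)|$ be the order of its center. Then $$\kappa(G)=2^{5m-5}m^{4m-2}.$$
   Context: A subset $X$ of a group is commuting if any two of its elements commute. For a nonabelian group $G$, an abelian subgroup $A\subseteq G$ and an integer $n\ge 2$, $G$ has an $n$-abelian partition with respect to $A$ if $G$ is the disjoint union $G=A\uplus A_1\uplus\cdots\uplus A_n$ of $A$ and $n$ commuting subsets $A_1,\dots,A_n$ of $G$ with $|A_i|>1$ for each $i$. For a finite group $G$, the commuting graph $\mathcal{C}(G)$ is the simple graph with vertex set $G$ in which two distinct elements are adjacent if and only if they commute. $\kappa(G)$ denotes the number of spanning trees of $\mathcal{C}(G)$. *)

(* Defs.v *)
From mathcomp Require Import all_boot all_fingroup all_solvable.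

Set Implicit Arguments.
Unset Strict Implicit.
Unset Printing Implicit Defensive.

Local Open Scope group_scope.

Section Graphs.

Variable T : finType.
Implicit Types (V : {set T}) (e r : rel T) (F : {set {set T}}).

(* A finite simple graph is given by a vertex set V and a relation e; loops
   are discarded and an edge is the two-element set of its endpoints. *)
Definition edge_set V e : {set {set T}} :=
  [set [set x; y] | x in V, y in V & (x != y) && e x y].

Definition adj F : rel T := fun x y => [set x; y] \in F.

Definition connected V F : bool :=
  [forall x in V, forall y in V, connect (adj F) x y].

(* Bounding the length of cycles by #|T| only serves decidability: see
   acyclicP. *)
Definition acyclic F : bool :=
  [forall k : 'I_#|T|.+1, forall p : k.-tuple T,
     (2 < k) ==> ~~ ucycleb (adj F) p].

Lemma acyclicP F :
  reflect (forall p : seq T, 2 < size p -> ~ ucycle (adj F) p) (acyclic F).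
Proof.
apply: (iffP forallP) => [acF p p_gt2 ucp | acF k].
  have lep : size p < #|T|.+1.
    by case/andP: ucp => _ /card_uniqP <-; rewrite ltnS max_card.
  have /forallP/(_ (in_tuple p)) := acF (Ordinal lep).
  by rewrite /= p_gt2 /= => /negP; apply.
apply/forallP=> p; apply/implyP=> k_gt2.
by apply/negP/acF; rewrite size_tuple.
Qed.

(* When F is a subset of edge_set V e, the graph (V, F) is a spanning subgraph
   of (V, e). *)
Definition spanning_tree V e F : bool :=
  [&& F \subset edge_set V e, connected V F & acyclic F].

Definition num_spanning_trees V e : nat :=
  #|[set F : {set {set T}} | spanning_tree V e F]|.

End Graphs.

Section Groups.

Variable gT : finGroupType.
Implicit Types (G A : {group gT}).

Definition commute_rel : rel gT := fun x y => x * y == y * x.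

Definition kappa G : nat := num_spanning_trees G commute_rel.

Definition has_abelian_partition G A (n : nat) : Prop :=
  [/\ 2 <= n, A \subset G, abelian A &
   exists B : 'I_n -> {set gT},
     [/\ forall i, 1 < #|B i|,
         forall i, {in B i &, forall x y, commute x y},
         forall i, [disjoint A & B i],
         forall i j, i != j -> [disjoint B i & B j]
       & G :=: A :|: \bigcup_(i < n) B i]].

End Groups.

(* Main.v *)
Require Import Defs.
From mathcomp Require Import all_boot all_fingroup all_solvable.
From mathcomp Require Import all_algebra ring.

(**
The subgroups generated by the three parts of the partition, joined with the
center Z, are abelian and cover G.  Three proper abelian subgroups H_i covering
G meet pairwise in Z, and each H_i \ Z is a single coset of Z, so |G : Z| = 4 and
two elements outside Z commute exactly when they lie in the same H_i.  The
commuting graph is therefore the join of a clique of order m with three disjoint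
cliques of order m.

Its spanning trees are counted by the reduced Laplacian determinant.  Rooting a
spanning tree at r turns it into a parent function, and expanding the
determinant by multilinearity gives a sum over all functions f fixing r in which
f contributes 1 if all its orbits reach r and 0 otherwise.  As rows of the
adjacency matrix depend only on the class of the vertex, Sylvester's identity
det (1 - U W) = det (1 - W U) reduces the determinant to one of size 1 + k, where
k is the number of disjoint cliques.
*)

(** * Functions whose orbits all reach a root *)

Section ParentFunctions.

Set Implicit Arguments.
Unset Strict Implicit.

Variables (T : finType) (r : T).
Implicit Types f : {ffun T -> T}.

Definition rooted f : bool := [forall v, fconnect f v r].

(** The number of steps needed to reach [r] is such a depth; conversely, a depth that drops at every
    vertex but [r] cannot drop forever. Arguments about orbits thus become inductions on [d]. *)
Lemma rootedP f :
  f r = r ->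
  reflect (exists d : T -> nat, forall v, v != r -> d (f v) < d v) (rooted f).
Proof.
move=> fr; apply: (iffP forallP) => [rf | [d dlt] v].
  exists (fun v => findex f v r) => v vr.
  have := iter_findex (rf v); case E: (findex f v r) => [|n] /=.
    by move/eqP; rewrite (negPf vr).
  rewrite -iterS iterSr => it; rewrite ltnS leqNgt; apply/negP=> lt_n.
  have ltn : n < #|fconnect f (f v)|.
    by rewrite (leq_trans lt_n) // ltnW // findex_max.
  by have := findex_iter ltn; rewrite it => E2; rewrite E2 ltnn in lt_n.
have [n] := ubnP (d v); elim: n v => // n IHn v; rewrite ltnS => le_dn.
have [->|vr] := eqVneq v r; first exact: connect0.
apply: connect_trans (fconnect1 f v) (IHn _ _).
exact: leq_trans (dlt _ vr) le_dn.
Qed.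

Lemma fconnect_root_step f v : f r = r -> fconnect f (f v) r = fconnect f v r.
Proof.
move=> fr; apply/idP/idP => [|]; first exact: connect_trans (fconnect1 f v).
move/iter_findex; case: (findex f v r) => [/= ->|n].
  by rewrite fr connect0.
by rewrite iterSr => <-; apply: fconnect_iter.
Qed.

End ParentFunctions.

(** * Spanning trees as parent functions *)

Section SpanningTrees.

Set Implicit Arguments.
Unset Strict Implicit.

Variables (T : finType) (V : {set T}) (e : rel T) (r : T).
Hypotheses (e_sym : symmetric e) (rV : r \in V).
Implicit Types (f : {ffun T -> T}) (F : {set {set T}}).

(* The value [r] outside [V :\ r] is a dummy making [f] a total function. *)
Definition parent_rel : rel T :=
  fun v u => if v \in V :\ r then (u \in V) && e v u else u == r.

Definition arborescence f : bool :=
  [forall v, parent_rel v (f v)] && rooted r f.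

Definition parent_edges f : {set {set T}} := [set [set v; f v] | v in V :\ r].

Lemma set2_eq (x y a b : T) :
  [set x; y] = [set a; b] -> x = a /\ y = b \/ x = b /\ y = a.
Proof.
move=> E; have := set21 x y; have := set22 x y; rewrite E !inE.
move=> /orP[] /eqP yE /orP[] /eqP xE; subst x y; try by auto.
  by have := set22 a b; rewrite -E !inE orbb => /eqP->; left.
by have := set21 a b; rewrite -E !inE orbb => /eqP->; left.
Qed.

Lemma adj_sym F : symmetric (adj F).
Proof. by move=> x y; rewrite /adj setUC. Qed.

Lemma mem_edge_set E :
  reflect (exists x y, [/\ E = [set x; y], x \in V, y \in V, x != y & e x y])
          (E \in edge_set V e).
Proof.
apply: (iffP imset2P) => [[x y xV]|[x [y [-> xV yV xy exy]]]].
  by rewrite inE => /and3P[yV xy exy] ->; exists x, y.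
by exists x y => //; rewrite inE yV xy.
Qed.

Lemma adj_edge_set F x y :
  F \subset edge_set V e -> adj F x y -> [/\ x \in V, y \in V, x != y & e x y].
Proof.
move=> /subsetP sFE /sFE /mem_edge_set[a [b [/set2_eq E aV bV ab eab]]].
by case: E => -[-> ->]; split=> //; rewrite 1?eq_sym 1?e_sym.
Qed.

Lemma adj_parent_edges f x y :
  reflect (x \in V :\ r /\ y = f x \/ y \in V :\ r /\ x = f y)
          (adj (parent_edges f) x y).
Proof.
apply: (iffP imsetP) => [[v vV /set2_eq[] [-> ->]] | [[xV ->]|[yV ->]]].
- by left.
- by right.
- by exists x.
by exists y => //; rewrite setUC.
Qed.

Lemma arborescence_root f : arborescence f -> f r = r.
Proof. by case/andP=> /forallP/(_ r); rewrite /parent_rel !inE eqxx => /eqP. Qed.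

Lemma arborescence_parent f v :
  arborescence f -> v \in V :\ r -> [/\ f v \in V, f v != v & e v (f v)].
Proof.
move=> af vV; have fr := arborescence_root af; case/andP: af => /forallP/(_ v).
rewrite /parent_rel vV => /andP[-> ->] /(rootedP fr)[d dlt]; split=> //.
have := dlt v; rewrite (setD1P vV).1 => /(_ isT).
by case: eqP => // ->; rewrite ltnn.
Qed.

Lemma arborescence_depth f :
  arborescence f -> exists d : T -> nat, forall v, v != r -> d (f v) < d v.
Proof. by move=> af; apply/rootedP; [apply: arborescence_root | case/andP: af]. Qed.

Lemma spanning_tree_parent_edges f :
  arborescence f -> spanning_tree V e (parent_edges f).
Proof.
move=> af; have [d dlt] := arborescence_depth af.
apply/and3P; split.
- apply/subsetP=> _ /imsetP[v vV ->]; apply/mem_edge_set.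
  have [fvV fvv ev] := arborescence_parent af vV.
  by exists v, (f v); split; rewrite // 1?eq_sym//; case/setD1P: vV.
- have to_r v : v \in V -> connect (adj (parent_edges f)) v r.
    have [n] := ubnP (d v); elim: n v => // n IHn v; rewrite ltnS => le_dn vV.
    have [->|vr] := eqVneq v r; first exact: connect0.
    have vV' : v \in V :\ r by rewrite !inE vr.
    have [fvV _ _] := arborescence_parent af vV'.
    apply: connect_trans (IHn _ (leq_trans (dlt _ vr) le_dn) fvV).
    by apply/connect1/adj_parent_edges; left.
  apply/'forall_implyP=> x xV; apply/'forall_implyP=> y yV.
  apply: connect_trans (to_r x xV) _.
  by rewrite (sym_connect_sym (@adj_sym _)) to_r.
- apply/acyclicP=> p p_gt2 ucp.
  have [x0 x0p] : exists x, x \in p.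
    by case: p p_gt2 {ucp} => // x p; exists x; apply: mem_head.
  (* At a vertex [x] of maximal depth on the cycle, a neighbour on the cycle cannot be a child of
     [x], so it is [f x]. The successor [y] and the predecessor [z] of [x] then coincide, which a
     cycle with more than two distinct vertices forbids. *)
  case: (@arg_maxnP _ x0 (mem p) d x0p) => x xp max_x.
  have /rot_to[i q rot_p] := xp.
  have max_q u : u \in x :: q -> d u <= d x.
    by rewrite -rot_p mem_rot; apply: max_x.
  have up u : adj (parent_edges f) x u -> u \in x :: q -> u = f x.
    move=> /adj_parent_edges[[]//|[uV xE]] /max_q.
    by rewrite xE leqNgt dlt //; case/setD1P: uV.
  move: p_gt2 ucp; rewrite -(size_rot i) -(rot_ucycle i) rot_p.
  case: q rot_p max_q up => // y q _ _ up.
  case/lastP: q up => // q z up _ /andP[/= /andP[xy]].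
  rewrite rcons_path last_rcons => /andP[_ zx] /andP[_ /andP[]].
  have -> : y = f x by apply: up; rewrite ?inE ?eqxx ?orbT.
  have <- : z = f x.
    by apply: up; rewrite 1?adj_sym // !inE mem_rcons mem_head !orbT.
  by rewrite mem_rcons mem_head.
Qed.

(** By induction on the depth for [f]: the edge from [v] to [f v] also comes from [g], so either
    [g v = f v] or [g (f v) = v]. In the second case the induction hypothesis at [f v] gives
    [f (f v) = v], and the depth would drop twice on the way from [v] to itself. *)
Lemma parent_edges_inj : {in [pred f | arborescence f] &, injective parent_edges}.
Proof.
move=> f g af ag E; have [d dlt] := arborescence_depth af.
have fr := arborescence_root af; have gr := arborescence_root ag.
have out h v : arborescence h -> v \notin V :\ r -> h v = r.
  by case/andP=> /forallP/(_ v) + _ vV; rewrite /parent_rel (negPf vV) => /eqP.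
apply/ffunP=> v; have [n] := ubnP (d v); elim: n v => // n IHn v.
rewrite ltnS => le_dn; have [vV|vV] := boolP (v \in V :\ r); last by rewrite !out.
have vr : v != r by case/setD1P: vV.
have : adj (parent_edges g) v (f v) by rewrite -E; apply/adj_parent_edges; left.
case/adj_parent_edges=> [[_ //]|[fvV vE]].
have fvr : f v != r by case/setD1P: fvV.
have lt_f := dlt _ vr.
have := dlt _ fvr; rewrite (IHn (f v)) ?(leq_trans lt_f)// -vE.
by rewrite ltnNge ltnW.
Qed.

(** Let [d] be the distance to [r] in [F], and let the parent of a vertex be any neighbour nearer to
    [r]. The resulting tree lies inside [F] and already connects [V], so acyclicity of [F] leaves no
    room for a further edge. *)
Lemma spanning_tree_arborescence F :
  spanning_tree V e F -> exists2 f, arborescence f & parent_edges f = F.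
Proof.
case/and3P=> sFE conF acF.
have /fin_all_exists[d dP] v : exists n, v \in V ->
    (exists p, [/\ path (adj F) v p, last v p = r & size p = n]) /\
    (forall p, path (adj F) v p -> last v p = r -> n <= size p).
  have [vV|] := boolP (v \in V); last by exists 0.
  pose P n := [exists p : n.-tuple T, path (adj F) v p && (last v p == r)].
  have exP : exists n, P n.
    have /'forall_implyP/(_ v vV)/'forall_implyP/(_ r rV) := conF.
    case/connectP=> p pp lp.
    by exists (size p); apply/existsP; exists (in_tuple p); rewrite pp -lp eqxx.
  case: (ex_minnP exP) => n /existsP[p /andP[pp /eqP lp]] minn.
  exists n => _; split; first by exists p; rewrite size_tuple.
  move=> q pq lq; apply: minn; apply/existsP; exists (in_tuple q).
  by rewrite pq lq eqxx.
have /fin_all_exists[f0 f0P] v : exists u,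
    if v \in V :\ r then adj F v u && (d u < d v) else u == r.
  have [/setD1P[vr vV]|_] := boolP (v \in V :\ r); last by exists r.
  have [[[|u p] [/= pp lp sp]] _] := dP v vV; first by rewrite lp eqxx in vr.
  have /andP[vu pu] := pp; exists u; rewrite vu -sp ltnS.
  have [_ uV _ _] := adj_edge_set sFE vu.
  by have [_] := dP u uV; apply.
pose f := finfun f0.
have fP v : v \in V :\ r -> adj F v (f v) /\ d (f v) < d v.
  by move=> vV; have := f0P v; rewrite vV ffunE => /andP.
have f_out v : v \notin V :\ r -> f v = r.
  by move=> vV; have := f0P v; rewrite (negPf vV) ffunE => /eqP.
have fr : f r = r by apply: f_out; rewrite !inE eqxx.
have af : arborescence f.
  apply/andP; split.
    apply/forallP=> v; rewrite /parent_rel.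
    case: ifPn => [/fP[adv _]|/f_out/eqP//].
    by have [_ -> _ ->] := adj_edge_set sFE adv.
  (* Outside [V] the value of [d] is arbitrary while the parent is [r]; giving [r] depth 0 and
     shifting all other depths by one makes the descent hold there too. *)
  apply/(rootedP fr); exists (fun v => if v == r then 0 else (d v).+1) => v vr.
  rewrite (negPf vr); case: eqP => // fvr; rewrite ltnS.
  by have [/fP[]|/f_out/fvr] := boolP (v \in V :\ r).
exists f => //; apply/eqP; rewrite eqEsubset; apply/andP; split.
  by apply/subsetP=> _ /imsetP[v vV ->]; have [] := fP v vV.
apply/subsetP=> E EF.
have /mem_edge_set[x [y [EE xV yV xy exy]]] := subsetP sFE E EF.
rewrite {}EE in EF *; apply/negPn/negP=> nadj.
(* A simple path from [x] to [y] along parent edges avoids the missing edge, so it has at least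
   three vertices and that edge closes it to a cycle in [F]. *)
have /and3P[_ conf _] := spanning_tree_parent_edges af.
have /'forall_implyP/(_ x xV)/'forall_implyP/(_ y yV) := conf.
case/connectP=> p0 pp0 lp0.
case/shortenP: pp0 lp0 => p pp up _ lp.
have sub : subrel (adj (parent_edges f)) (adj F).
  move=> a b /adj_parent_edges[[aV ->]|[bV ->]]; first by have [] := fP a aV.
  by rewrite adj_sym; have [] := fP b bV.
move/acyclicP: acF => /(_ (x :: p)) acF.
case: p => [|u [|w p]] in pp up lp acF.
- by rewrite lp eqxx in xy.
- by move: pp; rewrite /= andbT /adj -[u]lp (negPf nadj).
apply: acF => //; apply/andP; split=> //.
rewrite /path.cycle rcons_path (sub_path sub pp) -lp adj_sym; exact: EF.
Qed.

Lemma num_spanning_trees_arborescence :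
  num_spanning_trees V e = #|[set f | arborescence f]|.
Proof.
rewrite -(card_in_imset (f := parent_edges)); last first.
  by move=> f g; rewrite !inE => af ag; apply: parent_edges_inj.
apply: eq_card => F; rewrite inE; apply/idP/imsetP.
  by case/spanning_tree_arborescence=> f af <-; exists f; rewrite ?inE.
by case=> f; rewrite inE => af ->; apply: spanning_tree_parent_edges.
Qed.

End SpanningTrees.

(** * The matrix-tree theorem *)

Section MatrixTree.

Set Implicit Arguments.
Unset Strict Implicit.
Import GRing.Theory.
Local Open Scope ring_scope.

Variables (R : fieldType) (T : finType).
Implicit Types (r : T) (f : {ffun T -> T}).

Definition fin_mx (a : T -> T -> R) : 'M[R]_#|T| :=
  \matrix_(i, j) a (enum_val i) (enum_val j).

Lemma big_ord_enum_val (S : Type) (idx : S) (op : Monoid.com_law idx) (F : T -> S) :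
  \big[op/idx]_(i < #|T|) F (enum_val i) = \big[op/idx]_x F x.
Proof. by symmetry; apply: reindex; apply/onW_bij/enum_val_bij. Qed.

Lemma det_parent_matrix r f :
  f r = r ->
  \det (fin_mx (fun v x => (v == x)%:R - ((f v != r) && (f v == x))%:R))
  = (rooted r f)%:R.
Proof.
move=> fr; set B := fin_mx _; have [rf|/forallPn[x0 nx0]] := boolP (rooted r f).
  have [d dlt] := rootedP fr rf.
  have lt_d v x : v != x -> (f v != r) && (f v == x) -> (d x < d v)%N.
    move=> vx /andP[fvr /eqP <-]; apply: dlt.
    by apply: contraNneq fvr => ->; rewrite fr.
  rewrite /determinant (bigD1 1%g) //= [X in _ + X]big1 => [|s s_neq1].
    rewrite addr0 odd_perm1 mul1r big1 // => i _; rewrite perm1 mxE eqxx.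
    case: andP => [[fvr /eqP fvv]|]; last by rewrite subr0.
    by have := dlt _ fvr; rewrite !fvv ltnn.
  apply/eqP; rewrite mulf_eq0 signr_eq0 /=; apply/prodf_eq0.
  suff /existsP[i Bi0] : [exists i, B i (s i) == 0] by exists i.
  apply: contraT => /existsPn nz.
  (* If all factors of the term of [s] are nonzero, [s] never raises the depth. As a permutation it
     preserves the sum of the depths, so equality holds everywhere and [s] is the identity. *)
  have le_ds i : (d (enum_val (s i)) <= d (enum_val i)
                    ?= iff (s i == i))%N.
    apply/leqifP; case: eqP => [-> //|/eqP si].
    apply: lt_d; first by rewrite (inj_eq enum_val_inj) eq_sym.
    have := nz i; rewrite mxE (inj_eq enum_val_inj) [i == s i]eq_sym.
    rewrite (negPf si) sub0r oppr_eq0.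
    by case: (_ && _); rewrite ?eqxx.
  have := leqif_sum (P := xpredT) (fun i _ => le_ds i).
  rewrite (reindex_inj (@perm_inj _ s) (F := fun i => d (enum_val i))).
  case=> _; rewrite eqxx => /esym/forallP id_s; case/eqP: s_neq1; apply/permP=> i.
  by rewrite perm1; apply/eqP/id_s.
apply/eqP; rewrite -det_tr; apply/det0P.
(* The kernel vector is the indicator of the vertices whose orbit misses [r]: it takes the same
   value at [v] and [f v], and vanishes at [v] when [f v = r]. *)
exists (\row_j (~~ fconnect f (enum_val j) r)%:R).
  apply/eqP=> /rowP/(_ (enum_rank x0)); rewrite !mxE enum_rankK nx0.
  exact/eqP/oner_neq0.
apply/rowP=> i; rewrite !mxE; set v := enum_val i.
under eq_bigr => j _ do rewrite !mxE -/v.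
rewrite (big_ord_enum_val _ (fun x => (~~ fconnect f x r)%:R
  * ((v == x)%:R - ((f v != r) && (f v == x))%:R))).
under eq_bigr => x _ do rewrite mulrBr.
rewrite sumrB (bigD1 v) //= big1 => [|x xv]; last first.
  by rewrite eq_sym (negPf xv) mulr0.
rewrite (bigD1 (f v)) //= big1 => [|x xv]; last first.
  by rewrite [f v == x]eq_sym (negPf xv) andbF mulr0.
rewrite !eqxx andbT !addr0 mulr1 fconnect_root_step //.
case: eqP => [fvr|]; last by rewrite mulr1 subrr.
by rewrite -fconnect_root_step // fvr connect0 mul0r subrr.
Qed.

(** Row [v] is the sum over [u] of [w v u] times the row [v] of the matrix of [det_parent_matrix]
    for a function sending [v] to [u]. Expanding all rows at once gives a sum over functions [f];
    those moving [r] have weight 0 by the hypothesis on [w r], and the others contribute according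
    to whether they are rooted. *)
Lemma directed_matrix_tree r (w : T -> T -> R) :
  (forall u, u != r -> w r u = 0) ->
  \det (fin_mx (fun v x => (v == x)%:R * (\sum_u w v u) - (x != r)%:R * w v x))
  = \sum_(f | rooted r f) \prod_v w v (f v).
Proof.
move=> wr; pose B u v x : R := (v == x)%:R - ((u != r) && (u == x))%:R.
transitivity (\sum_(f : {ffun T -> T}) (\prod_v w v (f v)) *
    \det (fin_mx (fun v x => B (f v) v x))); last first.
  rewrite [RHS]big_mkcond; apply: eq_bigr => f _.
  have [fr|/eqP fr] := eqVneq (f r) r.
    by rewrite det_parent_matrix //; case: rooted; rewrite ?mulr1 ?mulr0.
  by rewrite (bigD1 r) //= wr ?mul0r ?if_same //; apply/eqP.
under [RHS]eq_bigr => f _ do rewrite mulr_sumr.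
rewrite exchange_big; apply: eq_bigr => s _ /=.
under [RHS]eq_bigr => f _ do rewrite mulrCA.
rewrite -mulr_sumr; congr (_ * _).
pose g v := enum_val (s (enum_rank v)).
transitivity (\prod_v \sum_u w v u * B u v (g v)).
  rewrite -big_ord_enum_val; apply: eq_bigr => i _.
  rewrite !mxE /g enum_valK; set x := enum_val (s i); set v := enum_val i.
  under [RHS]eq_bigr => u _ do rewrite mulrBr.
  rewrite sumrB -mulr_suml [X in X - _]mulrC; congr (_ - _).
  rewrite (bigD1 x) //= big1 => [|u ux]; last by rewrite (negPf ux) andbF mulr0.
  by rewrite eqxx andbT addr0 mulrC.
rewrite bigA_distr_bigA; apply: eq_bigr => f _; rewrite big_split; congr (_ * _).
rewrite -big_ord_enum_val; apply: eq_bigr => i _.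
by rewrite !mxE /g enum_valK.
Qed.

(** The dummy parent [r] makes the rows outside [V :\ r] unit rows, so this full-size determinant is
    that of the Laplacian with [r] deleted. A loop of [e] is counted both in the degree and in the
    subtracted diagonal entry, hence cancels. *)
Lemma num_spanning_trees_det (V : {set T}) (e : rel T) r :
  symmetric e -> r \in V ->
  (num_spanning_trees V e)%:R = \det (fin_mx (fun v x =>
    (v == x)%:R * #|[pred u | parent_rel V e r v u]|%:R
    - ((x != r) && parent_rel V e r v x)%:R)) :> R.
Proof.
move=> e_sym rV; pose w v u : R := (parent_rel V e r v u)%:R.
transitivity (\sum_(f | rooted r f) \prod_v w v (f v)).
  rewrite (num_spanning_trees_arborescence e_sym rV) -sum1_card natr_sum.
  rewrite big_mkcond [RHS]big_mkcond; apply: eq_bigr => f _.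
  rewrite inE /arborescence andbC; case: rooted => //=.
  have [/forallP pf|/forallPn[v nv]] :=
    boolP [forall v, parent_rel V e r v (f v)].
    by rewrite big1 // => v _; rewrite /w pf.
  by rewrite (bigD1 v) //= /w (negPf nv) mul0r.
rewrite -directed_matrix_tree => [|u ur]; last first.
  by rewrite /w /parent_rel !inE eqxx (negPf ur).
congr (\det _); apply/matrixP=> i j; rewrite !mxE /w -natr_sum.
congr (_ * _%:R - _); last by rewrite -natrM mulnb.
by rewrite -sum1_card [in RHS]big_mkcond.
Qed.

(** Both determinants are that of the block matrix with identity diagonal blocks and off-diagonal
    blocks [U] and [W], factored into triangular matrices in two ways. *)
Lemma det_sylvester n k (U : 'M[R]_(n, k)) (W : 'M[R]_(k, n)) :
  \det (1%:M - U *m W) = \det (1%:M - W *m U).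
Proof.
have E : block_mx (1%:M - U *m W) U 0 1%:M *m block_mx 1%:M 0 W 1%:M
       = block_mx 1%:M 0 W 1%:M *m block_mx 1%:M U 0 (1%:M - W *m U).
  rewrite !mulmx_block !mul0mx !mulmx0 !mulmx1 !mul1mx !addr0 !add0r.
  by rewrite subrK addrC subrK.
move/(congr1 determinant): E; rewrite !det_mulmx !det_ublock !det_lblock !det1.
by rewrite !mulr1 !mul1r.
Qed.

(* An arrowhead matrix, cleared by adding multiples of its last [k] rows to the
   first one. *)
Lemma det_arrowhead k (a b c d : R) :
  d != 0 ->
  \det (block_mx a%:M (const_mx b) (const_mx c) d%:M : 'M_(1 + k))
  = (a - k%:R * b * c / d) * d ^+ k.
Proof.
move=> d0; pose E : 'M[R]_(1 + k) := block_mx 1%:M (const_mx (- b / d)) 0 1%:M.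
have detE : \det E = 1 by rewrite det_ublock !det1 mulr1.
rewrite -[LHS]mul1r -{1}detE -det_mulmx mulmx_block.
rewrite !mul1mx !mul0mx !add0r mul_mx_scalar.
have -> : const_mx b + d *: const_mx (- b / d) = 0 :> 'rV_k.
  by apply/rowP=> i; rewrite !mxE mulrC divfK // subrr.
rewrite det_lblock det_scalar det_mx11 !mxE; congr ((_ + _) * _).
under eq_bigr => i _ do rewrite !mxE.
by rewrite sumr_const card_ord -[LHS]mulr_natl; ring.
Qed.

End MatrixTree.

(** * Cliques sharing a common clique *)

Section Windmill.

Set Implicit Arguments.
Unset Strict Implicit.
Import GRing.Theory Num.Theory.
Local Open Scope ring_scope.

(* The graph on [V] is the join of a clique [Z] with [k] disjoint cliques of
   order [s], namely the fibres of [c] in [V :\: Z]. *)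
Lemma num_spanning_trees_windmill (T : finType) (V Z : {set T}) (e : rel T)
    (k m s : nat) (c : T -> 'I_k) :
  symmetric e -> Z \subset V -> #|Z| = m -> (0 < m)%N -> (0 < k)%N -> (0 < s)%N ->
  {in V &, forall x y, e x y = [|| x \in Z, y \in Z | c x == c y]} ->
  (forall i, #|[set x in V :\: Z | c x == i]| = s) ->
  num_spanning_trees V e
  = ((m + k * s) ^ m.-1 * (m + s) ^ (k * s.-1) * m ^ k.-1)%N.
Proof.
move=> e_sym sZV cardZ m_gt0 k_gt0 s_gt0 eE cardK.
have /card_gt0P[r rZ] : (0 < #|Z|)%N by rewrite cardZ.
have rV : r \in V by apply: (subsetP sZV).
pose K i := [set x in V :\: Z | c x == i].
have KE x i : (x \in K i) = [&& x \notin Z, x \in V & c x == i].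
  by rewrite !inE andbA.
have ZK i : Z :&: K i = set0.
  by apply/setP=> x; rewrite !inE; case: (x \in Z).
have cardD : #|V :\: Z| = (k * s)%N.
  rewrite -sum1_card (partition_big c xpredT) //=.
  under eq_bigr => i _.
    rewrite (eq_bigl (mem (K i))) => [|x]; last by rewrite !inE.
    rewrite sum1_card [#|_|]cardK; over.
  by rewrite sum_nat_const card_ord.
have cardV : #|V| = (m + k * s)%N.
  by rewrite -(cardsID Z V) (setIidPr sZV) cardZ cardD.
pose n : rat := (m + k * s)%:R; pose t : rat := (m + s)%:R.
have n0 : n != 0 by rewrite pnatr_eq0; case: (m) m_gt0.
have t0 : t != 0 by rewrite pnatr_eq0; case: (m) m_gt0.
have m0 : m%:R != 0 :> rat by rewrite pnatr_eq0 -lt0n.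
(* The hypothesis on [e] makes it reflexive on [V], so these degrees count the vertex itself. *)
pose D v : rat := if v \in V :\ r then (if v \in Z then n else t) else 1.
have degE v : #|[pred u | parent_rel V e r v u]|%:R = D v :> rat.
  rewrite /D /parent_rel; case: ifP => [/setD1P[vr vV]|_]; last first.
    by rewrite (eq_card (B := pred1 r)) ?card1.
  have [vZ|vZ] := boolP (v \in Z).
    rewrite /n -cardV; congr (_%:R); apply: eq_card => u; rewrite !inE.
    by case: (boolP (u \in V)) => //= uV; rewrite eE // vZ.
  rewrite /t -cardZ -(cardK (c v)) -/(K _) -cardsUI ZK cards0 addn0; congr (_%:R).
  apply: eq_card => u; rewrite !inE; have [uZ|uZ] /= := boolP (u \in Z).
    by rewrite (subsetP sZV) // eE ?uZ ?orbT // (subsetP sZV).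
  by case: (boolP (u \in V)) => //= uV; rewrite eE // (negPf vZ) (negPf uZ) eq_sym.
(* Dividing each row by its degree leaves the identity minus a matrix of rank at most [1 + k]: the
   row of [v] depends only on its class. [w0] and [w1 i] are the neighbourhoods, without [r], of a
   vertex of [Z] and of [K i]; [u0] and [u1] select the class and divide by the degree. *)
pose u0 v : rat := ((v \in Z) && (v != r))%:R / n.
pose u1 v i : rat := (v \in K i)%:R / t.
pose w0 x : rat := ((x \in V) && (x != r))%:R.
pose w1 i x : rat := ((x != r) && (x \in Z :|: K i))%:R.
pose ev := @enum_val T T.
pose U : 'M[rat]_(#|T|, 1 + k) :=
  row_mx (\matrix_(v, j) u0 (ev v)) (\matrix_(v, i) u1 (ev v) i).
pose W : 'M[rat]_(1 + k, #|T|) :=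
  col_mx (\matrix_(j, x) w0 (ev x)) (\matrix_(i, x) w1 i (ev x)).
pose q : rat := (m.-1)%:R / n; pose p : rat := s%:R / t.
have WU : 1%:M - W *m U
    = block_mx (1 - q)%:M (const_mx (- p)) (const_mx (- q)) (1 - p)%:M.
  have sumE (P Q : pred T) (a : rat) j : #|[pred x | P x && Q x]| = j ->
      \sum_(i < #|T|) (P (ev i))%:R * ((Q (ev i))%:R / a) = j%:R / a.
    move=> <-; rewrite (big_ord_enum_val _ (fun x => (P x)%:R * ((Q x)%:R / a))).
    under eq_bigr => x _ do rewrite mulrA -natrM mulnb.
    by rewrite -mulr_suml -natr_sum -sum1_card [in RHS]big_mkcond.
  have cardZr : #|Z :\ r| = m.-1 by rewrite -cardZ (cardsD1 r Z) rZ.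
  rewrite mul_col_row scalar_mx_block opp_block_mx add_block_mx !add0r.
  congr block_mx; apply/matrixP=> i j; rewrite !mxE.
  - rewrite !ord1; congr (_ - _).
    under eq_bigr => x _ do rewrite !mxE.
    apply: (sumE (fun x => (x \in V) && (x != r))
                 (fun x => (x \in Z) && (x != r))).
    rewrite -cardZr; apply: eq_card => x; rewrite !inE.
    case: eqP => //=; rewrite ?andbF ?andbT // => _.
    by apply: andb_idl; apply: (subsetP sZV).
  - congr (- _); under eq_bigr => x _ do rewrite !mxE.
    apply: (sumE (fun x => (x \in V) && (x != r)) (fun x => x \in K j)).
    rewrite -(cardK j); apply: eq_card => x; rewrite !inE.
    have [->|xr] := eqVneq x r; first by rewrite rZ andbF.
    by case: (x \in V); rewrite ?andbF.
  - congr (- _); under eq_bigr => x _ do rewrite !mxE.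
    apply: (sumE (fun x => (x != r) && (x \in Z :|: K i))
                 (fun x => (x \in Z) && (x != r))).
    rewrite -cardZr; apply: eq_card => x; rewrite !inE.
    by case: (x == r); case: (x \in Z); rewrite ?andbF.
  rewrite mulrnBl; congr (_ - _); under eq_bigr => x _ do rewrite !mxE.
  rewrite (sumE (fun x => (x != r) && (x \in Z :|: K i)) (fun x => x \in K j) _
    (s *+ (i == j))) => [|]; last first.
    have [<-|ij] := eqVneq i j.
      rewrite -(cardK i); apply: eq_card => x; rewrite !inE.
      have [->|xr] := eqVneq x r; first by rewrite rZ.
      by case: (x \in Z); rewrite /= ?andbb.
    apply: eq_card0 => x; rewrite !inE; case: (x \in Z) => /=; rewrite ?andbF //.
    case: (eqVneq (c x) j) => [->|]; rewrite ?andbF //.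
    by rewrite [j == i]eq_sym (negPf ij) !andbF.
  by case: (i == j); rewrite ?mul0r.
have LE : fin_mx (fun v x => (v == x)%:R * #|[pred u | parent_rel V e r v u]|%:R
    - ((x != r) && parent_rel V e r v x)%:R)
    = diag_mx (\row_j D (ev j)) *m (1%:M - U *m W).
  apply/matrixP=> i j; rewrite mul_diag_mx mul_row_col !mxE degE -/ev.
  rewrite (inj_eq enum_val_inj) big_ord1 !mxE.
  under eq_bigr => l _ do rewrite !mxE.
  set v := ev i; set x := ev j.
  rewrite mulrBr mulrC; congr (_ - _).
  have [vV|vV] := boolP (v \in V :\ r); last first.
    rewrite big1 => [|l _]; last first.
      suff -> : u1 v l = 0 by rewrite mul0r.
      suff vK : v \notin K l by rewrite /u1 (negPf vK) mul0r.
      apply: contra vV; rewrite !inE => /andP[/andP[vZ ->] _].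
      by rewrite andbT; apply: contraNneq vZ => ->.
    have -> : u0 v = 0.
      suff vZ : ~~ ((v \in Z) && (v != r)) by rewrite /u0 (negPf vZ) mul0r.
      by apply: contra vV; rewrite !inE => /andP[/(subsetP sZV)-> ->].
    by rewrite mul0r addr0 mulr0 /parent_rel (negPf vV) andNb.
  rewrite /D /parent_rel vV; have /setD1P[vr vV'] := vV.
  have [vZ|vZ] := boolP (v \in Z).
    rewrite big1 => [|l _]; last by rewrite /u1 !inE vZ !mul0r.
    rewrite /u0 vZ vr addr0 mul1r mulrA mulfV // mul1r /w0 andbC.
    by case: (boolP (x \in V)) => // xV; rewrite eE // vZ.
  rewrite (bigD1 (c v)) //= big1 => [|l lv]; last first.
    by rewrite /u1 !inE eq_sym (negPf lv) andbF !mul0r.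
  rewrite /u0 (negPf vZ) !mul0r add0r addr0 /u1 /w1 !inE vZ vV' eqxx.
  rewrite mul1r mulrA mulfV // mul1r; congr (_ && _)%:R.
  have [xZ|xZ] /= := boolP (x \in Z).
    by rewrite (subsetP sZV) // eE ?xZ ?orbT // (subsetP sZV).
  by case: (boolP (x \in V)) => //= xV; rewrite eE // (negPf vZ) (negPf xZ) eq_sym.
have detD : \det (diag_mx (\row_j D (ev j))) = n ^+ m.-1 * t ^+ (k * s).
  rewrite det_diag; under eq_bigr => j _ do rewrite mxE.
  rewrite big_ord_enum_val.
  transitivity (\prod_v ((if v \in Z :\ r then n else 1)
                        * (if v \in V :\: Z then t else 1))).
    apply: eq_bigr => v _; rewrite /D !inE.
    have [->|vr] /= := eqVneq v r; first by rewrite rZ mulr1.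
    have [vZ|vZ] /= := boolP (v \in Z); first by rewrite (subsetP sZV) ?mulr1.
    by rewrite mul1r.
  rewrite big_split -!big_mkcond !prodr_const cardD.
  by rewrite -cardZ (cardsD1 r Z) rZ.
apply/eqP; rewrite -(eqr_nat rat) (num_spanning_trees_det _ e_sym rV).
have pE : 1 - p = m%:R / t.
  by apply: (mulIf t0); rewrite mulrBl !divfK // mul1r /t natrD; ring.
have nE : n = m%:R + k%:R * s%:R by rewrite /n natrD natrM.
have tE : t = m%:R + s%:R by rewrite /t natrD.
(* Since [p / (1 - p) = s / m], the left side is [1 - q * (n / m) = 1 - (m - 1) / m]. *)
have qE : 1 - q - k%:R * - p * - q / (1 - p) = m%:R^-1.
  rewrite pE /q /p -subn1 natrB //.
  by move: n0 t0; rewrite nE tE => n0 t0; field; rewrite m0 n0 t0.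
rewrite LE det_mulmx det_sylvester WU detD det_arrowhead; last first.
  by rewrite pE mulf_neq0 ?invr_eq0.
rewrite qE pE !natrM !natrX -/n -/t expr_div_n; apply/eqP.
have -> : (k * s)%N = (k * s.-1 + k)%N by rewrite -mulnSr prednK.
have -> : m%:R ^+ k = m%:R * m%:R ^+ k.-1 :> rat by rewrite -exprS prednK.
have tk0 : t ^+ k != 0 by rewrite expf_neq0.
rewrite exprD.
by field; rewrite tk0 m0.
Qed.

End Windmill.

(** * Groups covered by three abelian subgroups *)

Section AbelianCover.

Set Implicit Arguments.
Unset Strict Implicit.
Local Open Scope group_scope.

Variables (gT : finGroupType) (G : {group gT}).

Lemma third_ord (i j l l' : 'I_3) :
  i != j -> l != i -> l != j -> l' != i -> l' != j -> l = l'.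
Proof.
case: i j => [[|[|[|?]]] ?] [[|[|[|?]]] ?] //;
  by case: l l' => [[|[|[|?]]] ?] [[|[|[|?]]] ?] //= *; apply: val_inj.
Qed.

Variable H : 'I_3 -> {group gT}.
Hypotheses (G_nonabelian : ~~ abelian G) (sHG : forall i, H i \subset G)
  (abelH : forall i, abelian (H i)) (sZH : forall i, 'Z(G) \subset H i)
  (coverH : forall x, x \in G -> exists i, x \in H i).

Lemma cover_commute i x y : x \in H i -> y \in H i -> commute x y.
Proof. by move=> xH yH; apply: (centsP (abelH i)). Qed.

Lemma cover_avoid i j l x :
  i != j -> l != i -> l != j -> x \in G ->
  x \notin H i -> x \notin H j -> x \in H l.
Proof.
move=> ij li lj xG xi xj; have [l' xl'] := coverH xG.
rewrite (third_ord ij li lj (l' := l')) //.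
  by apply: contraNneq xi => <-.
by apply: contraNneq xj => <-.
Qed.

Lemma ord3_other (i j : 'I_3) : exists l, l != i /\ l != j.
Proof.
have /card_gt0P[l] : 0 < #|~: [set i; j]|.
  have := cardsC [set i; j]; rewrite card_ord cards2.
  by case: (i != j); case: #|_|.
by rewrite !inE negb_or => /andP[li lj]; exists l.
Qed.

(* If [c] in the third subgroup did not commute with [z], neither would [z * c],
   so both would lie in the third subgroup, and hence so would [z]. *)
Lemma cover_meet i j x : i != j -> x \in H i -> x \in H j -> x \in 'Z(G).
Proof.
move=> ij xi xj; have xG := subsetP (sHG i) x xi.
apply/centerP; split=> // c cG; apply/eqP; apply: contraT => /eqP xc.
have [l [li lj]] := ord3_other i j.
have ci : c \notin H i by apply/negP=> /(cover_commute xi).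
have cj : c \notin H j by apply/negP=> /(cover_commute xj).
have cl := cover_avoid ij li lj cG ci cj.
have xcl : x * c \in H l.
  by apply: (cover_avoid ij li lj); [exact: groupM | rewrite groupMl..].
by case: xc; apply: (cover_commute _ cl); rewrite groupMr in xcl.
Qed.

(** If [x * y] were in [H i], so would be [y], which would then be central by [cover_meet];
    symmetrically for [H j] and [x]. Only [H l] remains. *)
Lemma cover_mul i j l x y :
  i != j -> l != i -> l != j -> x \in H i :\: 'Z(G) -> y \in H j :\: 'Z(G) ->
  x * y \in H l.
Proof.
move=> ij li lj /setDP[xi xZ] /setDP[yj yZ].
have xG := subsetP (sHG i) x xi; have yG := subsetP (sHG j) y yj.
apply: (cover_avoid ij li lj); first exact: groupM.
  by rewrite groupMl //; apply: contra yZ => yi; apply: (cover_meet ij).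
by rewrite groupMr //; apply: contra xZ => xj; apply: (cover_meet ij).
Qed.

(** Two noncommuting elements [x] and [y] lie in different subgroups, and neither is central. The
    third subgroup contains [x * y], which does not commute with [x]. *)
Lemma cover_noncentral i : exists x, x \in H i :\: 'Z(G).
Proof.
have [x xG [y yG xy]] : exists2 x, x \in G & exists2 y, y \in G & x * y != y * x.
  have := G_nonabelian; rewrite /abelian => /subsetPn[x xG /centP cx].
  exists x => //; apply/exists_inP; apply: contraT.
  rewrite negb_exists_in => /forall_inP cy.
  by case: cx => y /cy /negPn/eqP.
have [ix xi] := coverH xG; have [iy yi] := coverH yG.
have ixy : ix != iy.
  by apply: contraNneq xy => E; rewrite E in xi; apply/eqP/(cover_commute xi).
have cent z w : z \in G -> z * w != w * z -> w \in G -> z \notin 'Z(G).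
  move=> zG zw wG; apply: contra zw => /centerP[_ cz]; exact/eqP/cz.
have xZ := cent x y xG xy yG; have yx : y * x != x * y by rewrite eq_sym.
have yZ := cent y x yG yx xG.
have [E|ixi] := eqVneq i ix; first by exists x; rewrite in_setD xZ E.
have [E|iyi] := eqVneq i iy; first by exists y; rewrite in_setD yZ E.
have xyH : x * y \in H i by apply: (cover_mul ixy); rewrite ?in_setD ?xZ ?yZ.
exists (x * y); rewrite in_setD xyH andbT.
apply: (cent _ x); rewrite ?groupM //.
by apply: contra xy => /eqP; rewrite -mulgA => /mulgI ->.
Qed.

Lemma ord3_neq (i : 'I_3) : exists j, j != i.
Proof. by have [j []] := ord3_other i i; exists j. Qed.

(** For [x] and [y] noncentral in [H i] and [h] noncentral in [H j], both [h * x] and [h * y] lie in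
    the third subgroup [H l]. Hence so does [x^-1 * y], which is also in [H i] and therefore
    central. *)
Lemma cover_lcoset i x : x \in H i :\: 'Z(G) -> H i :\: 'Z(G) = x *: 'Z(G).
Proof.
move=> xH; have /setDP[xi xZ] := xH; apply/setP=> y; rewrite mem_lcoset.
apply/idP/idP => [yH | zZ].
  have /setDP[yi yZ] := yH.
  have [j ji] := ord3_neq i; have [l [li lj]] := ord3_other j i.
  have [h hj] := cover_noncentral j.
  apply: (@cover_meet i l); [by rewrite eq_sym | by rewrite groupM ?groupV |].
  have hx := cover_mul ji li lj hj xH; have hy := cover_mul ji li lj hj yH.
  by have := groupM (groupVr hx) hy; rewrite invMg -!mulgA mulKg.
have zi := subsetP (sZH i) _ zZ.
have -> : y = x * (x^-1 * y) by rewrite mulKVg.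
by rewrite in_setD groupMr // xZ groupM.
Qed.

(** If [y] commuted with [x], it would centralize the cosets of the center through [x] and through
    [x * y], that is, the noncentral parts of [H i] and of the third subgroup, besides [H j]. It
    would then be central. *)
Lemma cover_noncommute i j x y :
  i != j -> x \in H i :\: 'Z(G) -> y \in H j :\: 'Z(G) -> ~ commute x y.
Proof.
move=> ij xH yH xy; have /setDP[xi xZ] := xH; have /setDP[yj yZ] := yH.
have xG := subsetP (sHG i) x xi; have yG := subsetP (sHG j) y yj.
have coset_commute l u g : u \in H l :\: 'Z(G) -> commute y u ->
    g \in H l :\: 'Z(G) -> commute y g.
  move=> uH yu; rewrite (cover_lcoset uH) => /lcosetP[z /centerP[_ cz] ->].
  by apply: commuteM => //; apply: commute_sym (cz y yG).
case/negP: yZ; apply/centerP; split=> // g gG.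
have [/centerP[_ cg]|gZ] := boolP (g \in 'Z(G)).
  exact: commute_sym (cg y yG).
have [l gl] := coverH gG; have gH : g \in H l :\: 'Z(G) by rewrite in_setD gZ.
have [E|lj] := eqVneq l j; first by apply: (cover_commute yj); rewrite -E.
have [E|li] := eqVneq l i.
  rewrite E in gH; exact: (coset_commute i x g xH (commute_sym xy) gH).
have xyl := cover_mul ij li lj xH yH.
apply: (coset_commute l (x * y)) => //; last first.
  by apply: commuteM => //; apply: commute_sym.
rewrite in_setD xyl andbT; apply: contra xZ => xyZ.
by apply: (cover_meet ij) => //; have := subsetP (sZH j) _ xyZ; rewrite groupMr.
Qed.

End AbelianCover.

(** * From a 2-abelian partition to the number of spanning trees *)

Section Partition.

Set Implicit Arguments.
Unset Strict Implicit.
Local Open Scope group_scope.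

Lemma abelian_partition_coloring (gT : finGroupType) (G A : {group gT}) :
  ~~ abelian G -> has_abelian_partition G A 2 ->
  exists c : gT -> 'I_3,
    {in G &, forall x y,
       commute_rel x y = [|| x \in 'Z(G), y \in 'Z(G) | c x == c y]}
    /\ forall i, #|[set x in G :\: 'Z(G) | c x == i]| = #|'Z(G)|.
Proof.
move=> nabG [_ sAG abelA [B [_ cB _ _ GE]]].
(* The three parts under one index: [A] at 0, then the two sets [B j]. *)
pose S (i : 'I_3) : {set gT} := oapp B (gval A) (unlift ord0 i).
have sSG i : S i \subset G.
  rewrite /S; case: unliftP => [j _|_] //=; rewrite GE subsetU //.
  by rewrite (bigcup_sup j) ?orbT.
have abelS i : abelian (S i).
  rewrite /S; case: unliftP => [j _|_] //=.
  by apply/centsP=> x xB y yB; apply: (cB j).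
pose H i := <<S i :|: 'Z(G)>>%G.
have sHG i : H i \subset G by rewrite gen_subG subUset sSG center_sub.
have sZH i : 'Z(G) \subset H i by rewrite sub_gen // subsetUr.
have abelH i : abelian (H i).
  have cSZ : 'Z(G) \subset 'C(S i).
    by rewrite (subset_trans (subsetIr _ _)) // centS.
  rewrite abelian_gen /abelian centU subsetI !subUset [S i \subset _]abelS cSZ.
  by rewrite centsC cSZ; apply: center_abelian.
have coverH x : x \in G -> exists i, x \in H i.
  move=> xG; suff [i xS] : exists i, x \in S i.
    by exists i; rewrite mem_gen // inE xS.
  move: xG; rewrite GE => /setUP[xA|/bigcupP[j _ xB]].
    by exists ord0; rewrite /S unlift_none.
  by exists (lift ord0 j); rewrite /S liftK.
have meetH := cover_meet sHG abelH coverH.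
(* The default is reached only outside [G]. A central element lies in all three subgroups and gets
   an arbitrary one of their indices; noncentral elements of [G] lie in exactly one. *)
pose c x := odflt ord0 [pick i | x \in H i].
have cH x : x \in G -> x \in H (c x).
  move=> xG; rewrite /c; case: pickP => //= noH.
  by have [i xi] := coverH x xG; have := noH i; rewrite xi.
have cE x i : x \in G :\: 'Z(G) -> (c x == i) = (x \in H i).
  case/setDP=> xG xZ; apply/eqP/idP => [<-|xi]; first exact: cH.
  by apply: contraNeq xZ => ci; apply: meetH ci (cH x xG) xi.
exists c; split=> [x y xG yG | i]; last first.
  have [x xH] := cover_noncentral nabG sHG abelH coverH i.
  rewrite -(card_lcoset _ x) -(cover_lcoset nabG sHG abelH sZH coverH xH).
  apply: eq_card => y; rewrite in_set.
  have [yD|yD] /= := boolP (y \in G :\: 'Z(G)).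
    by rewrite cE // in_setD; case/setDP: yD => _ ->.
  apply/esym/negbTE; apply: contra yD => /setDP[yH yZ].
  by rewrite in_setD yZ (subsetP (sHG i)).
rewrite /commute_rel; have [/centerP[_ cx]|xZ] /= := boolP (x \in 'Z(G)).
  exact/eqP/cx.
have [/centerP[_ cy]|yZ] /= := boolP (y \in 'Z(G)).
  exact/eqP/esym/cy.
have [cxy|cxy] := eqVneq (c x) (c y).
  by apply/eqP; apply: (cover_commute abelH (cH x xG)); rewrite cxy cH.
apply/negbTE/eqP.
by apply: (cover_noncommute nabG sHG abelH sZH coverH cxy);
  rewrite in_setD ?xZ ?yZ cH.
Qed.

End Partition.

Local Open Scope group_scope.

Theorem corollary4p5 (gT : finGroupType) (G : {group gT})
    (G_nonabelian : ~~ abelian G)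
    (G_partition : exists A : {group gT}, has_abelian_partition G A 2)
    (m : nat) (m_def : m = #|'Z(G)|) :
  kappa G = (2 ^ (5 * m - 5) * m ^ (4 * m - 2))%N.
Proof.
have [A GA] := G_partition.
have [c [comE cardc]] := abelian_partition_coloring G_nonabelian GA.
have m_gt0 : 0 < m by rewrite m_def cardG_gt0.
have com_sym : symmetric (@commute_rel gT) by move=> x y; apply: eq_sym.
rewrite /kappa (num_spanning_trees_windmill com_sym (center_sub G) (esym m_def)
  m_gt0 (isT : 0 < 3) m_gt0 comE) => [|i]; last by rewrite m_def; apply: cardc.
(* With three cliques of order [m] the count is [(4 m)^(m - 1) * (2 m)^(3 (m - 1)) * m^2]. Passing
   to the predecessor of [m] turns the truncated subtractions in the exponents into sums. *)
case: m m_gt0 {m_def} => // m _ /=.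
have -> : (m.+1 + 3 * m.+1 = 2 ^ 2 * m.+1)%N by rewrite -mulSn.
have -> : (m.+1 + m.+1 = 2 * m.+1)%N by rewrite mul2n addnn.
have -> : (5 * m.+1 - 5 = 2 * m + 3 * m)%N by rewrite mulnS addKn -mulnDl.
have -> : (4 * m.+1 - 2 = m + 3 * m + 2)%N by rewrite mulnS addnC -addnBA // -mulSn.
rewrite [((2 ^ 2 * _) ^ _)%N]expnMn [((2 * _) ^ _)%N]expnMn -expnM.
by rewrite mulnACA !expnD !mulnA.
Qed.
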